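(* There is a polynomial-time algorithm which, given a graph $G$ of diameter two that contains neither $C_3$ nor $C_7$ as an induced subgraph, decides whether $G$ admits a proper $3$-coloring.
   Context: A proper $3$-coloring of $G$ is a map $c: V(G)\to\{1,2,3\}$ with $c(u)\neq c(v)$ for every edge $uv$. The diameter of a graph is the maximum distance between two of its vertices; a diameter two graph is connected and any two vertices are at distance at most $2$. $C_k$ denotes the cycle on $k$ vertices. *)

(* Defs.v *)
From mathcomp Require Import all_boot.

Set Implicit Arguments.
Unset Strict Implicit.
Unset Printing Implicit Defensive.

Definition simple_graph (V : finType) (e : rel V) : Prop :=
  symmetric e /\ irreflexive e.

Definition is_distance (V : finType) (e : rel V) (x y : V) (k : nat) : Prop :=
  (exists p : seq V, [/\ path e x p, last x p = y & size p = k]) /\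
  (forall p : seq V, path e x p -> last x p = y -> k <= size p).

(* Vertices in different components are at no (finite) distance.  The complete
   graphs (diameter 0 or 1) are included. *)
Definition diameter_two (V : finType) (e : rel V) : Prop :=
  (forall x y : V, connect e x y) /\
  (forall x y : V, exists2 k, is_distance e x y k & k <= 2).

(* Meant for k >= 3. *)
Definition cycle_graph (k : nat) : rel 'I_k :=
  fun i j => (j == i.+1 %% k :> nat) || (i == j.+1 %% k :> nat).

Arguments cycle_graph k i j : clear implicits.

Definition induced_subgraph (W V : finType) (h : rel W) (e : rel V) : Prop :=
  exists2 f : W -> V, injective f & forall x y : W, e (f x) (f y) = h x y.

Definition three_colorable (V : finType) (e : rel V) : Prop :=
  exists c : V -> 'I_3, forall u v : V, e u v -> c u != c v.

(* Programs over natural-number variables and one-dimensional unbounded arrays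
   of natural numbers, both named by natural numbers; a program mentions
   finitely many of them.  Every operation has unit cost.  The only arithmetic
   is addition and truncated subtraction: with N a bound on the numbers in the
   input and in the program, t steps produce numbers of at most t + log N bits,
   so running time agrees up to a polynomial with Turing machine time.
   Unit-cost multiplication would break this and is deliberately absent. *)

Inductive expr : Type :=
  | Const of nat
  | Var of nat
  | Get of nat & expr
  | Add of expr & expr
  | Sub of expr & expr.

Inductive cmd : Type :=
  | Skip
  | Assign of nat & expr
  | Put of nat & expr & expr
  | Seq of cmd & cmd
  | If of expr & cmd & cmd
  | While of expr & cmd.

Record state : Type := State {
  var : nat -> nat;
  arr : nat -> nat -> nat
}.

Definition upd (T : Type) (f : nat -> T) (x : nat) (v : T) : nat -> T :=
  fun y => if y == x then v else f y.

Fixpoint eval (s : state) (a : expr) : nat :=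
  match a with
  | Const k => k
  | Var x => var s x
  | Get x b => arr s x (eval s b)
  | Add b c => eval s b + eval s c
  | Sub b c => eval s b - eval s c
  end.

Fixpoint cost (a : expr) : nat :=
  match a with
  | Const _ | Var _ => 1
  | Get _ b => (cost b).+1
  | Add b c | Sub b c => (cost b + cost c).+1
  end.

Definition assign (s : state) (x v : nat) : state :=
  State (upd (var s) x v) (arr s).

Definition put (s : state) (x i v : nat) : state :=
  State (var s) (upd (arr s) x (upd (arr s x) i v)).

(* [exec c s t s']: started in s, c halts in state s' after t steps.  A test
   is true when its value is nonzero. *)
Inductive exec : cmd -> state -> nat -> state -> Prop :=
  | ExecSkip s : exec Skip s 1 s
  | ExecAssign s x a :
      exec (Assign x a) s (cost a).+1 (assign s x (eval s a))
  | ExecPut s x a b :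
      exec (Put x a b) s (cost a + cost b).+1 (put s x (eval s a) (eval s b))
  | ExecSeq c d s t s' u s'' :
      exec c s t s' -> exec d s' u s'' -> exec (Seq c d) s (t + u) s''
  | ExecIfTrue a c d s t s' :
      eval s a != 0 -> exec c s t s' -> exec (If a c d) s (cost a + t).+1 s'
  | ExecIfFalse a c d s t s' :
      eval s a == 0 -> exec d s t s' -> exec (If a c d) s (cost a + t).+1 s'
  | ExecWhileFalse a c s :
      eval s a == 0 -> exec (While a c) s (cost a).+1 s
  | ExecWhileTrue a c s t s' u s'' :
      eval s a != 0 -> exec c s t s' -> exec (While a c) s' u s'' ->
      exec (While a c) s (cost a + t + u).+1 s''.

Lemma exec_deterministic c s t1 s1 t2 s2 :
  exec c s t1 s1 -> exec c s t2 s2 -> t1 = t2 /\ s1 = s2.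
Proof.
move=> H; elim: H t2 s2 => {c s t1 s1} [||| c d s t s' u s'' _ IHc _ IHd
  |a c d s t s' Ha _ IH|a c d s t s' Ha _ IH|a c s Ha
  |a c s t s' u s'' Ha _ IHc _ IHw] *;
  match goal with H : exec _ _ _ _ |- _ => inversion H; subst; clear H end;
  try by [].
- match goal with H : exec c _ _ _ |- _ => case: (IHc _ _ H) => ? ?; subst end.
  by match goal with H : exec d _ _ _ |- _ => case: (IHd _ _ H) => ? ?; subst end.
- by match goal with H : exec c _ _ _ |- _ => case: (IH _ _ H) => ? ?; subst end.
- by match goal with H : is_true (_ == 0) |- _ => rewrite H in Ha end.
- by match goal with H : is_true (_ != 0) |- _ => rewrite Ha in H end.
- by match goal with H : exec d _ _ _ |- _ => case: (IH _ _ H) => ? ?; subst end.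
- by match goal with H : is_true (_ != 0) |- _ => rewrite Ha in H end.
- by match goal with H : is_true (_ == 0) |- _ => rewrite H in Ha end.
- match goal with H : exec c _ _ _ |- _ => case: (IHc _ _ H) => ? ?; subst end.
  match goal with H : exec (While _ _) _ _ _ |- _ =>
    by case: (IHw _ _ H) => ? ?; subst end.
Qed.

(* Variable 0 holds the number n of vertices and array 0 the adjacency matrix,
   row by row: cell i * n + j is 1 if i and j are adjacent.  Every other
   variable and cell is 0. *)
Definition input (n : nat) (e : rel 'I_n) : state :=
  State (fun x => if x == 0 then n else 0)
        (fun x a => if x == 0 then
           nat_of_bool [exists i : 'I_n, exists j : 'I_n,
                          (a == i * n + j) && e i j]
         else 0).

Definition accepting (s : state) : Prop := var s 0 != 0.

(* A promise problem: on graphs outside [promise] nothing is required, not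
   even termination.  The input has size n ^ 2, so a polynomial bound in n is
   a polynomial bound in the input size. *)
Definition polytime_decidable
    (promise problem : forall n : nat, rel 'I_n -> Prop) : Prop :=
  exists (c : cmd) (a d : nat),
  forall (n : nat) (e : rel 'I_n), simple_graph e -> promise n e ->
  exists (t : nat) (s : state),
    [/\ exec c (input e) t s,
        t <= a * n ^ d + a
      & accepting s <-> problem n e].

(* Main.v *)
Require Import Defs.
From mathcomp Require Import all_boot.
From mathcomp Require Import zify.

(* If some vertex p has neighbours q, r in the two other colours, let s be a
   vertex of p's colour, distinct from p and nonadjacent to q and r, that
   minimises |N(s) & N(p)|.  Let w be a common neighbour of s and p, say of q's
   colour, and x one of s and q, necessarily of r's colour.  Guess p, s, q, w,
   r, x with their colours.  Suppose that y has no guessed neighbour, and no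
   neighbour seeing two guessed colours.  Then N(y) & N(p) is contained in N(s):
   otherwise take z in N(y) & N(p) outside N(s) and a common neighbour t of y
   and x, and y z p w s x t is an induced C7.  If y had p's colour, minimality
   would give N(y) & N(p) = N(s) & N(p), which contains w, although y is not
   adjacent to w.  So y avoids p's colour.  Hence the guess forbids one colour
   at every vertex, and what remains is an instance of 2-SAT, solved by
   propagating each of the two colours of each vertex.  A colouring with no such
   p leaves a colour unused, so the constant forbidden colour works. *)

Set Implicit Arguments.
Unset Strict Implicit.
Unset Printing Implicit Defensive.

(** * Triangle-free graphs of diameter two without induced C7 *)

Lemma common_neighbor (V : finType) (e : rel V) : simple_graph e -> diameter_two e ->
  forall x y, x != y -> ~~ e x y -> exists2 z, e x z & e y z.
Proof.
move=> [es _] [_ dist] x y xy nxy.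
have [k [[p [pp lp sp]] _] k2] := dist x y.
rewrite -{k}sp in k2.
case: p pp lp k2 => [|z [|t [|//]]] /= pp lp _.
- by rewrite lp eqxx in xy.
- by case/andP: pp nxy; rewrite lp => ->.
- by case/and3P: pp => xz zt _; exists z; rewrite // es -lp.
Qed.

Lemma triangle_free (V : finType) (e : rel V) : simple_graph e ->
  ~ induced_subgraph (cycle_graph 3) e ->
  forall x y z, e x y -> e y z -> e x z = false.
Proof.
move=> [es ei] nC x y z xy yz; apply/negP => xz; apply: nC.
have [yx zy zx]: [/\ e y x, e z y & e z x] by rewrite es xy es yz es xz.
pose f (i : 'I_3) := nth x [:: x; y; z] i.
have fE i j : e (f i) (f j) = cycle_graph 3 i j.
  by case: i => [[|[|[|//]]] ?]; case: j => [[|[|[|//]]] ?];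
    rewrite /f /cycle_graph /= ?ei ?(xy, yz, xz, yx, zy, zx).
(* Distinct vertices of C_3 are adjacent and [e] is irreflexive, so equal images force equal
   indices. *)
exists f => // i j fij; have := fE i j; rewrite fij ei.
by case: i {fij} => [[|[|[|//]]] ?]; case: j => [[|[|[|//]]] ?] => //= _; apply: val_inj.
Qed.

Lemma no_induced_heptagon (V : finType) (e : rel V) : simple_graph e ->
  ~ induced_subgraph (cycle_graph 7) e ->
  forall x0 x1 x2 x3 x4 x5 x6,
  [&& e x0 x1, e x1 x2, e x2 x3, e x3 x4, e x4 x5, e x5 x6 & e x6 x0] ->
  [|| e x0 x2, e x0 x3, e x0 x4, e x0 x5, e x1 x3, e x1 x4, e x1 x5, e x1 x6,
      e x2 x4, e x2 x5, e x2 x6, e x3 x5, e x3 x6 | e x4 x6].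
Proof.
move=> [es ei] nC x0 x1 x2 x3 x4 x5 x6 edges.
apply/negPn/negP; rewrite !negb_or => nonedges; apply: nC.
pose f (i : 'I_7) := nth x0 [:: x0; x1; x2; x3; x4; x5; x6] i.
have fE_lt (i j : 'I_7) : i <= j -> e (f i) (f j) = cycle_graph 7 i j.
  move: edges nonedges; do 6![case/andP => ? ]; move=> ?.
  do 13![case/andP => /negbTE ? ]; move/negbTE => ?.
  case: i => [[|[|[|[|[|[|[|//]]]]]]] ?]; case: j => [[|[|[|[|[|[|[|//]]]]]]] ?];
    rewrite /f /cycle_graph //= ?ei //= => _; solve [assumption | by rewrite es].
have cycle_sym i j : cycle_graph 7 i j = cycle_graph 7 j i by rewrite /cycle_graph orbC.
have fE i j : e (f i) (f j) = cycle_graph 7 i j.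
  by case/orP: (leq_total i j) => ij; [|rewrite es cycle_sym]; apply: fE_lt.
exists f => // i j fij.
(* Distinct vertices of C_7 have distinct neighbourhoods, already among the vertices 0 to 5. Hence
   adjacency alone makes [f] injective. *)
have {fE fij}: forall k, cycle_graph 7 i k = cycle_graph 7 j k.
  by move=> k; rewrite -!fE fij.
rewrite /cycle_graph => E; apply: val_inj.
move: (E (inord 0)) (E (inord 1)) (E (inord 2)) (E (inord 3)) (E (inord 4)) (E (inord 5)).
rewrite !inordK //.
by case: i {E} => [[|[|[|[|[|[|[|//]]]]]]] ?]; case: j => [[|[|[|[|[|[|[|//]]]]]]] ?].
Qed.

(** * Guessing six coloured vertices *)

Definition near (V : finType) (e : rel V) (s t v : V) : bool := e v s || e v t.

(** [A], [B] and [C] stand for the vertices adjacent to a guessed vertex of each of the three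
    colours. At an unreduced [y] the guess excludes no colour directly: [y] has no guessed
    neighbour, and no neighbour of [y] has its colour determined by two guessed colours. *)
Definition unreduced (V : finType) (e : rel V) (A B C : pred V) (y : V) : Prop :=
  ~~ [|| A y, B y | C y] /\
  forall z, e y z -> ~~ [|| A z && B z, A z && C z | B z && C z].

Definition coloring (V : finType) (e : rel V) (c : V -> nat) : Prop :=
  (forall v, c v < 3) /\ forall u v, e u v -> c u != c v.

(** Otherwise [y z p w s x t] has no chord. At [y], because [y] has no guessed neighbour; at [z] and
    [t], because [z] sees [p] and [t] sees [x], so neither sees a guessed vertex of another colour,
    and [z s] is excluded by assumption. The pairs [z t], [p x] and [w x] would close triangles with
    [y], [q] and [s], and [p], [s] have the same colour. *)
Lemma unreduced_common_neighbor (V : finType) (e : rel V) : simple_graph e -> diameter_two e ->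
  ~ induced_subgraph (cycle_graph 3) e -> ~ induced_subgraph (cycle_graph 7) e ->
  forall (c : V -> nat) p q r s w x y z, coloring e c -> c p = c s ->
  [&& e p q, e p w, e s w, e s x & e q x] ->
  unreduced e (near e p s) (near e q w) (near e r x) y ->
  e y z -> e z p -> e z s.
Proof.
move=> sg dia nC3 nC7 c p q r s w x y z [_ pc] cps /and5P[pq pw sw sx qx] [ny nr] yz zp.
have tri := triangle_free sg nC3; have [es ei] := sg.
move: (ny); rewrite /near !negb_or => /and3P[/andP[yp ys] /andP[yq yw] /andP[yr yx]].
have yneqx : y != x by apply: contraNneq ys => ->; rewrite es.
have [t yt xt] := common_neighbor sg dia yneqx yx.
apply/negPn/negP => zs.
have := no_induced_heptagon sg nC7 (x0 := y) (x1 := z) (x2 := p) (x3 := w) (x4 := s) (x5 := x) (x6 := t).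
rewrite yz zp pw (es w) sw sx xt (es t) yt => /(_ isT).
move: (nr z yz) (nr t yt); rewrite /near zp /= !negb_or => /and3P[zBn zCn _].
move: zBn zCn => /andP[zq zw] /andP[zr zx].
rewrite (es t x) xt !orbT !andbT /= !negb_or.
case/andP=> _ /andP[/andP[tp ts] /andP[tq tw]].
rewrite (negbTE yp) (negbTE yw) (negbTE ys) (negbTE yx) (negbTE zw) (negbTE zs) (negbTE zx).
rewrite (tri z y t) ?(es z) //  (es p t) (negbTE tp) (es w t) (negbTE tw) (es s t) (negbTE ts).
rewrite (tri p q x) // (tri w s x) // 1?es //.
by rewrite !orbF => ps; have := pc _ _ ps; rewrite cps eqxx.
Qed.

Lemma exists_guess (V : finType) (e : rel V) : simple_graph e -> diameter_two e ->
  ~ induced_subgraph (cycle_graph 3) e -> ~ induced_subgraph (cycle_graph 7) e ->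
  forall c b d p q r, coloring e c -> b < 3 -> d < 3 -> b != d ->
  e p q -> e p r -> c q = b -> c r = d ->
  exists b' d' s q' w r' x,
  [/\ [&& b' < 3, d' < 3, b' != d', b' != c p & d' != c p],
      [&& c s == c p, c q' == b', c w == b', c r' == d' & c x == d'] &
      forall y, unreduced e (near e p s) (near e q' w) (near e r' x) y -> c y != c p].
Proof.
move=> sg dia nC3 nC7 c b d p q r cc b3 d3 bd pq pr cq cr.
have [es ei] := sg; have [c3 pc] := cc.
have bp : b != c p by rewrite -cq; apply: pc; rewrite es.
have dp : d != c p by rewrite -cr; apply: pc; rewrite es.
pose P := [pred y | [&& c y == c p, y != p, ~~ e y q & ~~ e y r]].
have unreducedP s w x y : unreduced e (near e p s) (near e q w) (near e r x) y ->
    c y = c p -> P y.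
  case; rewrite /near !negb_or /= => /and3P[_ /andP[yq _] /andP[yr _]] _ ->.
  by rewrite eqxx yq yr !andbT /=; apply: contraNneq yq => ->.
(* Without a candidate for [s], each guessed vertex is repeated: an unreduced vertex of the colour
   of [p] would itself be a candidate. *)
case: (pickP P) => [s0 Ps0|P0]; last first.
  exists b, d, p, q, q, r, r; split; rewrite ?b3 ?d3 ?bd ?bp ?dp ?cq ?cr ?eqxx //.
  by move=> y uy; apply/negP => /eqP cy; have := unreducedP _ _ _ _ uy cy; rewrite P0.
pose common y := [set z | e y z && e p z].
have [s Ps smin] := arg_minnP (fun y => #|common y|) Ps0.
have {Ps} /and4P[/eqP cs sp sq sr] := Ps.
have [w sw pw] : exists2 z, e s z & e p z.
  by apply: common_neighbor => //; apply/negP => /pc; rewrite cs eqxx.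
have finish y : P y -> (forall z, e y z -> e z p -> e z s) -> e y w.
  move=> Py sub.
  have le : common y \subset common s.
    apply/subsetP => z; rewrite !inE /= => /andP[yz pz].
    by rewrite pz es sub // es.
  have /eqP eq : common y == common s by rewrite eqEcard le smin.
  have : w \in common s by rewrite inE sw pw.
  by rewrite -eq inE => /andP[].
have wcase : (c w == b) || (c w == d).
  by move: (c3 w) (c3 p) (pc _ _ pw); lia.
have {finish unreducedP smin Ps0} key w' x y :
    unreduced e (near e p s) (near e q w') (near e r x) y -> c y = c p ->
    (forall z, e y z -> e z p -> e z s) -> e y w.
  by move=> uy cy; apply: finish; apply: unreducedP uy cy.
(* [w] has colour [b] or [d], and exchanging [b], [q] with [d], [r] reduces to the first case. What
   minimality gave enters through [key], whose hypothesis [unreduced] survives the exchange up to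
   permuting [B] and [C]. *)
move: {P}key; wlog cw : b d q r b3 d3 bd pq pr cq cr bp dp sq sr wcase / c w == b.
  move=> base key; case/orP: (wcase) => cw; first exact: (base b d q r).
  apply: (base d b r q) => //; first by rewrite eq_sym.
    by rewrite orbC.
  move=> w' x y [A B] cy; apply: (key x w') cy; split.
    by move: A; do 3!case: near.
  by move=> z /B; do 3!case: near.
move: cw => /eqP cw key.
have [x sx qx] : exists2 z, e s z & e q z.
  by apply: common_neighbor => //; apply: contraNneq bp => sq'; rewrite -cs sq' cq.
have cx : c x = d.
  by move: (pc _ _ sx) (pc _ _ qx) (c3 x) (c3 p); lia.
exists b, d, s, q, w, r, x; split; rewrite ?b3 ?d3 ?bd ?bp ?dp ?cq ?cr ?cs ?cw ?cx ?eqxx //.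
move=> y uy; apply/eqP => cy.
have yw : e y w.
  apply: (key _ _ _ uy cy) => z yz zp; apply: (unreduced_common_neighbor sg dia nC3 nC7 cc _ _ uy yz zp) => //.
  by rewrite pq pw sw sx qx.
by case: uy; rewrite /near yw !orbT.
Qed.

Lemma recolor (V : finType) (e : rel V) (c : V -> nat) a b : coloring e c -> a < 3 -> b < 3 -> a != b ->
  exists2 f, coloring e (f \o c) & [/\ f a = 0, f b = 1 & forall d, d < 3 -> d != a -> d != b -> f d = 2].
Proof.
move=> [c3 pc] a3 b3 ab.
exists (fun d => if d == a then 0 else if d == b then 1 else 2).
  split=> [v|u v uv] /=; first by case: ifP => // _; case: ifP.
  by move: (c3 u) (c3 v) (pc _ _ uv); do ![case: eqP => //]; lia.
split=> [||d d3 /negbTE-> /negbTE-> //]; first by rewrite eqxx.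
by rewrite eq_sym (negbTE ab) eqxx.
Qed.

Lemma normalized_guess (V : finType) (e : rel V) : simple_graph e -> diameter_two e ->
  ~ induced_subgraph (cycle_graph 3) e -> ~ induced_subgraph (cycle_graph 7) e ->
  (exists c, coloring e c) ->
  exists2 c, coloring e c & (forall v, c v != 0) \/
  exists p s q w r x,
  [/\ c p = 0, c s = 0, c q = 1, c w = 1 & [/\ c r = 2, c x = 2 &
    forall y, unreduced e (near e p s) (near e q w) (near e r x) y -> c y != 0]].
Proof.
move=> sg dia nC3 nC7 [c cc]; have [es ei] := sg; have [c3 pc] := cc.
have unused a b : a < 3 -> b < 3 -> a != b -> (forall v, c v != a) ->
    exists2 c, coloring e c & forall v, c v != 0.
  move=> a3 b3 ab na; have [f cf [fa fb fd]] := recolor cc a3 b3 ab.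
  exists (f \o c) => // v /=; have [->|nb] := eqVneq (c v) b; first by rewrite fb.
  by rewrite fd.
case: (pickP (fun v => c v == 0)) => [u /eqP cu|n0]; last first.
  by exists c => //; left=> v; rewrite n0.
case: (pickP (fun v => c v == 1)) => [v /eqP cv|n1]; last first.
  have [//|c' ? ?] := @unused 1 0 isT isT isT _; first by move=> v; rewrite n1.
  by exists c' => //; left.
case: (pickP (fun v => c v == 2)) => [t /eqP ct|n2]; last first.
  have [//|c' ? ?] := @unused 2 0 isT isT isT _; first by move=> v'; rewrite n2.
  by exists c' => //; left.
(* All three colours occur, at [u], [v] and [t]. Either [u] is adjacent to both [v] and [t], or a
   common neighbour of [u] and a nonadjacent one of them serves as [p]. *)
have [p [q [r [pq pr qr]]]] : exists p q r, [/\ e p q, e p r & c q != c r].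
  have [uv|uv] := boolP (e u v); last first.
    have [|z uz vz] := common_neighbor sg dia _ uv; first by apply: contra_eq_neq cv => <-; rewrite cu.
    by exists z, u, v; rewrite !(es z) uz vz cu cv.
  have [ut|ut] := boolP (e u t); first by exists u, v, t; rewrite uv ut cv ct.
  have [|z uz tz] := common_neighbor sg dia _ ut; first by apply: contra_eq_neq ct => <-; rewrite cu.
  by exists z, u, t; rewrite !(es z) uz tz cu ct.
have [b [d [s [q' [w [r' [x [/and5P[b3 d3 bd bp dp] /and5P[/eqP cs /eqP cq /eqP cw /eqP cr /eqP cx] free]]]]]]]] :=
  exists_guess sg dia nC3 nC7 cc (c3 q) (c3 r) qr pq pr erefl erefl.
have [|f cf [fp fb fd]] := recolor cc (c3 p) b3 _; first by rewrite eq_sym.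
have fd2 : f d = 2 by apply: fd; rewrite // eq_sym.
exists (f \o c) => //; right; exists p, s, q', w, r', x.
split; rewrite /= ?cs ?cq ?cw //; split; rewrite /= ?cr ?cx // => y /free cy.
have [->|nb] := eqVneq (c y) b; first by rewrite fb.
by rewrite fd.
Qed.

(** * Colouring with one forbidden colour per vertex *)

(** The 2-SAT argument: [M b w] says that colour [b] is forced at [w], and a colour at [u] forces at
    a neighbour [w] the colour different from it and from [X w]. If from every vertex some colour
    propagates without contradiction, these local solutions can be added one after another without
    ever revising a colour. *)
Lemma avoiding_coloring (V : finType) (e : rel V) (X : V -> nat) : simple_graph e ->
  (forall v, X v < 3) ->
  (forall v, exists2 a, a < 3 & exists M : nat -> V -> bool,
    [/\ M a v,
        forall u w b b', e u w -> b < 3 -> M b u -> b' < 3 -> b' != b -> b' != X w -> b != X w -> M b' w,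
        forall b w, M b w -> b < 3 /\ b != X w
      & forall b b' w, M b w -> M b' w -> b = b']) ->
  exists c, coloring e c.
Proof.
move=> [es ei] X3 M_ex.
(* [P] is the set of vertices coloured so far. A coloured vertex has the forbidden colour of each of
   its uncoloured neighbours, and so does not constrain them. *)
suff ext m (P : {set V}) c : #|~: P| <= m ->
    (forall v, v \in P -> c v < 3 /\ c v != X v) ->
    (forall u v, u \in P -> e u v -> if v \in P then c u != c v else c u == X v) ->
    exists c, coloring e c.
  by apply: (ext _ set0 (fun=> 0) (leqnn _)) => [v|u v]; rewrite inE.
elim: m P c => [|m IHm] P c sz cX pc.
  have PT v : v \in P.
    by move: sz; rewrite leqn0 cards_eq0 => /eqP/setP/(_ v); rewrite !inE; case: (v \in P).
  exists c; split=> [v|u v uv]; first by case: (cX v (PT v)).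
  by have := pc u v (PT u) uv; rewrite PT.
case: (pickP [pred v | v \notin P]) => [v /= vP|PT]; last first.
  apply: (IHm P c) => //; rewrite (_ : ~: P = set0) ?cards0 //.
  by apply/setP => v; have := PT v; rewrite !inE.
have [a a3 [M [Mv Mcl MX Mfun]]] := M_ex v.
(* On [D] this is the marked colour, unique by [Mfun]; the value 2 outside [D] is a default that no
   coloured vertex receives. *)
pose g w := if M 0 w then 0 else if M 1 w then 1 else 2.
pose D := [set w | [|| M 0 w, M 1 w | M 2 w]].
have Mg w : w \in D -> M (g w) w.
  by rewrite inE /g; case: ifP => // _; case: ifP.
have MD b w : M b w -> w \in D.
  by move=> bw; have [b3 _] := MX _ _ bw; rewrite inE; case: b b3 bw => [|[|[|//]]] _ ->; rewrite ?orbT.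
apply: (IHm (P :|: D) (fun w => if w \in P then c w else g w)).
- rewrite -ltnS; apply: leq_trans sz; apply: proper_card; apply/properP; split.
    by rewrite setCS subsetUl.
  by exists v; rewrite !in_setC ?vP // negbK in_setU (MD _ _ Mv) orbT.
- move=> w; rewrite in_setU; case: ifP => [/cX //|_ /= /Mg Mw].
  exact: MX Mw.
(* On an edge between [P] and a new vertex, the end in [P] has the forbidden colour of the other
   end, which [g] avoids. *)
move=> u w; rewrite !in_setU; case: (boolP (u \in P)) => [uP _ uw|/negbTE uP /= uD uw].
  have := pc _ _ uP uw; case: (boolP (w \in P)) => //= wP /eqP cu; case: ifP => [wD|_]; last by rewrite cu.
  by rewrite cu eq_sym; case: (MX _ _ (Mg _ wD)).
have [u3 uX] := MX _ _ (Mg _ uD).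
case: (boolP (w \in P)) => [wP|/negbTE wP] /=.
  have := pc w u wP; rewrite es uP => /(_ uw) /eqP ->; exact: uX.
have forced : g u != X w -> exists2 b, b != g u & M b w.
  move=> guX; have [b [b3 bu bX]] : exists b, [/\ b < 3, b != g u & b != X w].
    have /orP[/orP[]|] : (((0 != g u) && (0 != X w)) || ((1 != g u) && (1 != X w))) || ((2 != g u) && (2 != X w)).
    - by move: (X3 w); lia.
    - by case/andP=> ? ?; exists 0.
    - by case/andP=> ? ?; exists 1.
    - by case/andP=> ? ?; exists 2.
  by exists b => //; apply: (Mcl u w (g u) b uw u3 (Mg _ uD)).
case: ifP => wD.
  have [E|guX] := eqVneq (g u) (X w).
    by rewrite E eq_sym; case: (MX _ _ (Mg _ wD)).
  have [b bu bw] := forced guX.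
  by rewrite (Mfun _ _ _ (Mg _ wD) bw) eq_sym.
(* If [g u] were not [X w], a colour would be forced at [w], and [w] would lie in [D]. *)
apply: contraFT wD => /forced[b _]; exact: MD.
Qed.

(** * Structured programs with loops bounded by the number of vertices *)

(** Every loop runs a number of times fixed on entry, so programs are total: they have a denotation
    [den] and a polynomial [time], and correctness can be proved without reference to [exec]. *)
Inductive prog : Type :=
  | PSkip
  | PAssign of nat & expr
  | PPut of nat & expr & expr
  | PSeq of prog & prog
  | PIf of expr & prog & prog
  | PFor of nat & prog.

(* [PFor x p] runs [p] with variable [x] ranging over [0 .. n - 1], where [n]
   is the value of variable 0. *)
Fixpoint compile (p : prog) : cmd :=
  match p with
  | PSkip => Skip
  | PAssign x a => Assign x a
  | PPut x a b => Put x a b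
  | PSeq p q => Seq (compile p) (compile q)
  | PIf a p q => If a (compile p) (compile q)
  | PFor x p => Seq (Assign x (Const 0))
      (While (Defs.Sub (Var 0) (Var x)) (Seq (compile p) (Assign x (Add (Var x) (Const 1)))))
  end.

Fixpoint den (p : prog) (s : state) : state :=
  match p with
  | PSkip => s
  | PAssign x a => assign s x (eval s a)
  | PPut x a b => put s x (eval s a) (eval s b)
  | PSeq p q => den q (den p s)
  | PIf a p q => if eval s a != 0 then den p s else den q s
  | PFor x p => iteri (var s 0) (fun k s => assign (den p s) x k.+1) (assign s x 0)
  end.

Fixpoint assigned (p : prog) : seq nat :=
  match p with
  | PSkip | PPut _ _ _ => [::]
  | PAssign x _ => [:: x]
  | PSeq p q | PIf _ p q => assigned p ++ assigned q
  | PFor x p => x :: assigned p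
  end.

Fixpoint written (p : prog) : seq nat :=
  match p with
  | PSkip | PAssign _ _ => [::]
  | PPut x _ _ => [:: x]
  | PSeq p q | PIf _ p q => written p ++ written q
  | PFor _ p => written p
  end.

(** These conditions make [den] and [time] agree with the compiled program: a loop body changes
    neither its counter nor variable 0, which bounds the loops, and both halves of a sequence start
    with the same value in variable 0. *)
Fixpoint well_scoped (p : prog) : bool :=
  match p with
  | PSeq p q => [&& 0 \notin assigned p, well_scoped p & well_scoped q]
  | PIf _ p q => well_scoped p && well_scoped q
  | PFor x p => [&& x != 0, x \notin assigned p, 0 \notin assigned p & well_scoped p]
  | _ => true
  end.

(** In a loop, an iteration costs 4 for the test and 4 for the increment besides the body; the final
    6 is 2 for initialising the counter and 4 for the failing test. *)
Fixpoint time (p : prog) (n : nat) : nat :=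
  match p with
  | PSkip => 1
  | PAssign _ a => (cost a).+1
  | PPut _ a b => (cost a + cost b).+1
  | PSeq p q => time p n + time q n
  | PIf a p q => (cost a + time p n + time q n).+1
  | PFor _ p => n * (time p n + 8) + 6
  end.

Lemma den_var p s y : y \notin assigned p -> var (den p s) y = var s y.
Proof.
elim: p s => //= [x a|p IHp q IHq|a p IHp q IHq|x p IHp] s.
- by rewrite inE /upd => /negbTE->.
- by rewrite mem_cat negb_or => /andP[yp yq]; rewrite IHq ?IHp.
- by rewrite mem_cat negb_or => /andP[yp yq]; case: ifP => _; [apply: IHp|apply: IHq].
rewrite inE negb_or => /andP[/negbTE yx yp].
by elim: (var s 0) => [|m IHm] /=; rewrite /upd yx // IHp.
Qed.

Lemma den_arr p s y : y \notin written p -> arr (den p s) y = arr s y.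
Proof.
elim: p s => //= [x a b|p IHp q IHq|a p IHp q IHq|x p IHp] s.
- by rewrite inE /upd => /negbTE->.
- by rewrite mem_cat negb_or => /andP[yp yq]; rewrite IHq ?IHp.
- by rewrite mem_cat negb_or => /andP[yp yq]; case: ifP => _; [apply: IHp|apply: IHq].
by move=> yp; elim: (var s 0) => [|m IHm] //=; rewrite IHp.
Qed.

Lemma exec_compile p s : well_scoped p ->
  exists2 t, exec (compile p) s t (den p s) & t <= time p (var s 0).
Proof.
elim: p s => /= [|x a|x a b|p IHp q IHq|a p IHp q IHq|x p IHp] s.
- by exists 1; first exact: ExecSkip.
- by exists (cost a).+1; first exact: ExecAssign.
- by exists (cost a + cost b).+1; first exact: ExecPut.
- case/and3P=> p0 /(IHp s)[t ext tb] /(IHq (den p s))[u exu ub].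
  exists (t + u); first exact: ExecSeq ext exu.
  by rewrite den_var // in ub; apply: leq_add.
- case/andP=> /(IHp s)[t ext tb] /(IHq s)[u exu ub]; case: ifPn => sa.
    by exists (cost a + t).+1; [apply: ExecIfTrue|lia].
  rewrite negbK in sa.
  by exists (cost a + u).+1; [apply: ExecIfFalse|lia].
case/and4P=> x0 xp p0 wp; set n := var s 0.
pose loop := While (Defs.Sub (Var 0) (Var x)) (Seq (compile p) (Assign x (Add (Var x) (Const 1)))).
pose st k := iteri k (fun k s => assign (den p s) x k.+1) (assign s x 0).
have st0 k : var (st k) 0 = n.
  by elim: k => [|k IHk] /=; rewrite /upd eq_sym (negbTE x0) ?den_var.
have stx k : var (st k) x = k by case: k => [|k] /=; rewrite /upd eqxx.
(* [st k] is the state after [k] iterations; the induction is on the number of iterations that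
   remain. *)
have run k : k <= n -> exists2 t, exec loop (st (n - k)) t (st n) & t <= k * (time p n + 8) + 4.
  elim: k => [_|k IHk kn].
    rewrite subn0; exists 4 => //; apply: ExecWhileFalse.
    by rewrite /= st0 stx subnn.
  have [u exu ub] := IHk (ltnW kn).
  have [t ext tb] := IHp (st (n - k.+1)) wp; rewrite st0 in tb.
  exists (3 + (t + 4) + u).+1; last by lia.
  apply: (ExecWhileTrue (s' := st (n - k))) exu; first by rewrite /= st0 stx; lia.
  apply: ExecSeq ext _.
  rewrite (_ : st (n - k) = assign (den p (st (n - k.+1))) x
      (eval (den p (st (n - k.+1))) (Add (Var x) (Const 1)))); first exact: ExecAssign.
  by rewrite /= den_var // stx addn1 -(subnSK kn).
have [t ext tb] := run n (leqnn n); rewrite subnn in ext.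
exists (2 + t); last by lia.
exact: (ExecSeq (ExecAssign s x (Const 0)) ext).
Qed.

Lemma time_poly p : exists a d, forall n, time p n <= a * n ^ d + a.
Proof.
(* Powers of [n.+1] are positive and increase with the exponent, which makes such bounds easy to
   add. For positive [n], [n.+1] is at most [2 * n], whence the factor [2 ^ d]. *)
suff [a [d bnd]] : exists a d, forall n, time p n <= a * n.+1 ^ d.
  exists (a * 2 ^ d), d => n; apply: leq_trans (bnd n) _.
  rewrite -mulnA -mulnDr leq_mul2l -expnMn; apply/orP; right.
  case: n => [|n]; first by rewrite exp1n -[1]addn0 addnC leq_add // expn_gt0.
  apply: leq_trans (leq_addr _ _); case: d {bnd} => [|d] //; rewrite leq_exp2r //; lia.
have mono a b d d' n : d <= d' -> a <= b -> a * n.+1 ^ d <= b * n.+1 ^ d'.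
  by move=> dd ab; rewrite leq_mul // leq_pexp2l.
elim: p => /= [|x a|x a b|p [a [d IHp]] q [b [d' IHq]]|k p [a [d IHp]] q [b [d' IHq]]|x p [a [d IHp]]].
- by exists 1, 0.
- by exists (cost a).+1, 0 => n; rewrite muln1.
- by exists (cost a + cost b).+1, 0 => n; rewrite muln1.
- exists (a + b), (maxn d d') => n; rewrite mulnDl.
  apply: leq_add; [apply: leq_trans (IHp n) _|apply: leq_trans (IHq n) _]; apply: mono => //.
    exact: leq_maxl.
  exact: leq_maxr.
- exists ((cost k).+1 + (a + b)), (maxn d d') => n.
  have := leq_trans (IHp n) (mono _ _ _ _ _ (leq_maxl d d') (leqnn a)).
  have := leq_trans (IHq n) (mono _ _ _ _ _ (leq_maxr d d') (leqnn b)).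
  have : 0 < n.+1 ^ maxn d d' by rewrite expn_gt0.
  by move: (n.+1 ^ maxn d d') => E; nia.
exists (a + 14), d.+1 => n.
have := IHp n; have : 0 < n.+1 ^ d by rewrite expn_gt0.
by rewrite expnS; nia.
Qed.

(** * Proof rules for loops and sequences *)

Lemma for_invariant (I : nat -> state -> Prop) x p s :
  (forall k s v, I k s -> I k (assign s x v)) ->
  (forall k s', k < var s 0 -> I k s' -> var s' x = k -> I k.+1 (den p s')) ->
  I 0 s -> I (var s 0) (den (PFor x p) s).
Proof.
move=> Ix Ip I0 /=; have : var s 0 <= var s 0 by [].
move: {1 3 4}(var s 0) => m.
suff : m <= var s 0 -> I m (iteri m (fun k s => assign (den p s) x k.+1) (assign s x 0)) /\
   var (iteri m (fun k s => assign (den p s) x k.+1) (assign s x 0)) x = m by move=> H /H[].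
elim: m => [|m IHm] /= mn; first by split; [apply: Ix|rewrite /upd eqxx].
have [Im xm] := IHm (ltnW mn).
by split; [apply: Ix; apply: Ip|rewrite /upd eqxx].
Qed.

Lemma for_preserves (I : state -> Prop) x p s :
  (forall s v, I s -> I (assign s x v)) ->
  (forall s', var s' x < var s 0 -> I s' -> I (den p s')) ->
  I s -> I (den (PFor x p) s).
Proof.
move=> Ix Ip; apply: (@for_invariant (fun=> I)) => [k s' v|k s' kn Is xk]; first exact: Ix.
by apply: Ip; rewrite ?xk.
Qed.

(** For loops in which one iteration does the work, such as meeting a given edge, a conflict or the
    right guess: iteration [k0] establishes [J], and later ones keep it. *)
Lemma for_reaches (I J : state -> Prop) k0 x p s :
  k0 < var s 0 ->
  (forall s v, I s -> I (assign s x v)) ->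
  (forall s v, J s -> J (assign s x v)) ->
  (forall s', var s' x < var s 0 -> I s' -> I (den p s')) ->
  (forall s', var s' x < var s 0 -> I s' -> J s' -> J (den p s')) ->
  (forall s', var s' x = k0 -> I s' -> J (den p s')) ->
  I s -> J (den (PFor x p) s).
Proof.
move=> k0n Ix Jx Ip Jp hit I0.
suff [_] : (fun k s => I s /\ (k0 < k -> J s)) (var s 0) (den (PFor x p) s) by apply.
apply: (for_invariant (I := fun k s => I s /\ (k0 < k -> J s))) => [k s' v [? H]|k s' kn [Is Js] xk|] //.
- by split=> [|/H]; [apply: Ix|apply: Jx].
- split; first by apply: Ip; rewrite ?xk.
  rewrite ltnS leq_eqVlt => /orP[/eqP E|/Js ?]; first by apply: hit; rewrite ?xk.
  by apply: Jp; rewrite ?xk.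
Qed.

Definition seqs : seq prog -> prog := foldr PSeq PSkip.

Definition when (a : expr) (p : prog) : prog := PIf a p PSkip.

Lemma den_when a p s : den (when a p) s = if eval s a != 0 then den p s else s.
Proof. by []. Qed.

Definition unless (a : expr) (p : prog) : prog := PIf a PSkip p.

Definition equals (a : expr) (k : nat) : expr :=
  Defs.Sub (Const 1) (Add (Defs.Sub a (Const k)) (Defs.Sub (Const k) a)).

Lemma eval_equals s a k : (eval s (equals a k) != 0) = (eval s a == k).
Proof. by rewrite /=; lia. Qed.

Lemma seqs_preserves (I : state -> Prop) l s :
  (forall p, List.In p l -> forall s, I s -> I (den p s)) -> I s -> I (den (seqs l) s).
Proof.
elim: l s => //= p l IHl s Il Is; apply: IHl => [q ql|]; first by apply: Il; right.
by apply: Il => //; left.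
Qed.

Lemma seqs_reaches (I J : state -> Prop) p l s : List.In p l ->
  (forall q, List.In q l -> forall s, I s -> I (den q s)) ->
  (forall q, List.In q l -> forall s, J s -> J (den q s)) ->
  (forall s, I s -> J (den p s)) -> I s -> J (den (seqs l) s).
Proof.
elim: l s => //= q l IHl s pl Il Jl hit Is.
case: pl => [->|pl].
  by apply: (@seqs_preserves J) => [q' ql|]; [apply: Jl; right|apply: hit].
by apply: IHl => // [q' ql|q' ql|]; [apply: Il|apply: Jl|apply: Il => //]; auto.
Qed.

(** * Deciding whether a colouring avoids the forbidden colours *)

Lemma In_map (T : eqType) (f : T -> prog) l q : List.In q (map f l) -> exists2 t, t \in l & q = f t.
Proof.
elim: l => //= t l IHl [<-|/IHl[t' tl ->]]; first by exists t; rewrite ?mem_head.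
by exists t'; rewrite // in_cons tl orbT.
Qed.

Lemma map_In (T : eqType) (f : T -> prog) l t : t \in l -> List.In (f t) (map f l).
Proof. by elim: l => //= t' l IHl; rewrite inE => /orP[/eqP->|/IHl]; [left|right]. Qed.

(* Array 0: adjacency matrix; array 1: the offset i * n of row i; array 2: the
   forbidden colour of each vertex; array 3 + b: whether propagation has given
   colour b to a vertex. *)

Definition adj (x y : nat) : expr := Get 0 (Add (Get 1 (Var x)) (Var y)).

Definition color_orders : seq (nat * nat * nat) :=
  [:: (0, 1, 2); (0, 2, 1); (1, 0, 2); (1, 2, 0); (2, 0, 1); (2, 1, 0)].

(** For adjacent vertices in variables 10 and 11: if the first has colour [b] and the second has
    forbidden colour [f], the second gets the remaining colour [b']. *)
Definition force (t : nat * nat * nat) : prog :=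
  let: (b, f, b') := t in
  when (Get (3 + b) (Var 10)) (when (equals (Get 2 (Var 11)) f) (PPut (3 + b') (Var 11) (Const 1))).

Definition propagate : prog :=
  PFor 10 (PFor 11 (when (adj 10 11) (seqs (map force color_orders)))).

Definition context (n : nat) (e : rel 'I_n) (X : 'I_n -> nat) (s : state) : Prop :=
  [/\ var s 0 = n, forall i j : 'I_n, arr s 0 (i * n + j) = e i j,
      forall i : 'I_n, arr s 1 i = i * n & forall i : 'I_n, arr s 2 i = X i].

Lemma context_den n (e : rel 'I_n) X p s :
  0 \notin assigned p -> [&& 0 \notin written p, 1 \notin written p & 2 \notin written p] ->
  context e X s -> context e X (den p s).
Proof. by move=> p0 /and3P[w0 w1 w2] [? ? ? ?]; split; rewrite ?den_var ?den_arr. Qed.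

Lemma context_assign n (e : rel 'I_n) X s x v :
  x != 0 -> context e X s -> context e X (assign s x v).
Proof. by move=> x0 [s0 ? ? ?]; split; rewrite //= /upd eq_sym (negbTE x0). Qed.

Lemma eval_adj n (e : rel 'I_n) X s x y (i j : 'I_n) : context e X s ->
  var s x = i -> var s y = j -> (eval s (adj x y) != 0) = e i j.
Proof. by case=> _ se s1 _ xi yj; rewrite /= xi yj s1 se eqb0 negbK. Qed.

Definition mark (s : state) (b v : nat) : bool := arr s (3 + b) v != 0.

Lemma mark_put s b v a w : mark (put s (3 + b) v 1) a w = (a == b) && (w == v) || mark s a w.
Proof. by rewrite /mark /= /upd eqn_add2l; case: (eqVneq a b) => [->|//] /=; case: (w == v). Qed.

Lemma mark_den p s b v : 3 + b \notin written p -> mark (den p s) b v = mark s b v.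
Proof. by move=> bp; rewrite /mark den_arr. Qed.

Lemma color_ordersP b f b' : ((b, f, b') \in color_orders) =
  [&& b < 3, f < 3, b' < 3, b != f, b != b' & f != b'].
Proof.
apply/idP/idP; first by rewrite !inE => /or4P[|||/or3P[]] /eqP[-> -> ->].
case/and5P=> b3 f3 b'3 bf /andP[bb' fb'].
by case: b f b' b3 f3 b'3 bf bb' fb' => [|[|[|//]]] [|[|[|//]]] [|[|[|//]]].
Qed.

(** The closure condition of [avoiding_coloring]. *)
Definition closed_under_forcing (n : nat) (e : rel 'I_n) (X : 'I_n -> nat)
    (C : nat -> 'I_n -> bool) : Prop :=
  forall u w b b', e u w -> b < 3 -> C b u -> b' < 3 -> b' != b -> b' != X w -> b != X w -> C b' w.

Lemma mark_force_mono s t b v : mark s b v -> mark (den (force t) s) b v.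
Proof.
case: t => [[a f] a'] bv; rewrite /force /when; cbn [den].
by do 2!case: ifP => _ //; rewrite mark_put bv orbT.
Qed.

Lemma mark_propagate_mono s b v : mark s b v -> mark (den propagate s) b v.
Proof.
pose I s : Prop := mark s b v; rewrite -!/(I _).
apply: (@for_preserves I) => // s1 _ I1; apply: (@for_preserves I) => // s2 _ I2.
rewrite den_when; case: ifP => // _.
apply: (@seqs_preserves I) I2 => q /In_map[[[a f] a'] _ ->] s3; exact: mark_force_mono.
Qed.

Lemma den_force n (e : rel 'I_n) X s (u w : 'I_n) b f b' : context e X s ->
  var s 10 = u -> var s 11 = w ->
  den (force (b, f, b')) s = if mark s b u && (X w == f) then put s (3 + b') w 1 else s.
Proof.
case=> _ _ _ sX su sw; rewrite /force !den_when; rewrite eval_equals.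
by rewrite /mark /= su sw sX; case: (_ != 0) => //=.
Qed.

(** Propagation never leaves a closed family that contains the initial marks. Two families matter
    later: the non-forbidden colours, for soundness, and the colours of a given colouring, for
    completeness. *)
Lemma propagate_below n (e : rel 'I_n) X C s : closed_under_forcing e X C -> context e X s ->
  (forall b (v : 'I_n), b < 3 -> mark s b v -> C b v) ->
  forall b (v : 'I_n), b < 3 -> mark (den propagate s) b v -> C b v.
Proof.
move=> Ccl cs sC.
pose I s := context e X s /\ forall b (v : 'I_n), b < 3 -> mark s b v -> C b v.
suff [] : I (den propagate s) by [].
have Iassign x s' v : x != 0 -> I s' -> I (assign s' x v).
  by move=> x0 [cs' ?]; split=> //; apply: context_assign.
have [s0 _ _ _] := cs.
apply: (@for_preserves I) => // s1 u_lt I1.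
have s10 : var s1 0 = n by case: I1 => -[].
rewrite s0 in u_lt; pose u := Ordinal u_lt.
suff [] : I (den (PFor 11 (when (adj 10 11) (seqs (map force color_orders)))) s1) /\
  var (den (PFor 11 (when (adj 10 11) (seqs (map force color_orders)))) s1) 10 = u by [].
apply: (@for_preserves (fun s => I s /\ var s 10 = u)) => // s2 w_lt [I2 s2u].
rewrite s10 in w_lt; pose w := Ordinal w_lt.
rewrite den_when (eval_adj (j := w) (proj1 I2) s2u erefl).
case: ifP => // uw.
suff [? []] : I (den (seqs (map force color_orders)) s2) /\
  var (den (seqs (map force color_orders)) s2) 10 = u /\
  var (den (seqs (map force color_orders)) s2) 11 = w by [].
apply: (@seqs_preserves (fun s => I s /\ var s 10 = u /\ var s 11 = w)) => //.
move=> q /In_map[[[b f] b'] ord ->] s3 [I3 [s3u s3w]].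
rewrite (den_force _ _ _ (proj1 I3) s3u s3w).
case: ifP => // /andP[bu /eqP Xw]; split=> //; case: I3 => cs3 below; split.
  by case: cs3.
move=> a v a3; rewrite mark_put => /orP[/andP[/eqP-> /eqP/val_inj->]|]; last exact: below.
move: ord; rewrite color_ordersP -Xw => /and5P[b3 _ b'3 bX /andP[bb' Xb']].
by apply: (Ccl u w b b') => //; [exact: below|rewrite eq_sym|rewrite eq_sym].
Qed.

(** The two loops reach the pair [u], [w], and there the rule with forbidden colour [X w] marks
    [b']; no mark is erased before or after. *)
Lemma propagate_step n (e : rel 'I_n) (X : 'I_n -> nat) s : (forall v, X v < 3) -> context e X s ->
  forall (u w : 'I_n) b b', e u w -> b < 3 -> mark s b u -> b' < 3 -> b' != b -> b' != X w ->
  b != X w -> mark (den propagate s) b' w.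
Proof.
move=> X3 cs u w b b' uw b3 bu b'3 b'b b'X bX.
have ord : (b, X w, b') \in color_orders.
  by rewrite color_ordersP b3 X3 b'3 bX (eq_sym b) b'b eq_sym.
pose I s := context e X s /\ mark s b u; pose J s : Prop := mark s b' w; rewrite -/(J _).
have Iassign x s' v : x != 0 -> I s' -> I (assign s' x v).
  by move=> x0 [cs' ?]; split=> //; apply: context_assign.
have mono p' s' b0 v0 : mark s' b0 v0 -> mark (den (when p' (seqs (map force color_orders))) s') b0 v0.
  rewrite den_when => I2; case: ifP => // _.
  by apply: (@seqs_preserves (fun s => mark s b0 v0)) => // q /In_map[[[a f] a'] _ ->] s3; exact: mark_force_mono.
have Istep s' : I s' -> I (den (when (adj 10 11) (seqs (map force color_orders))) s').
  by case=> cs' bu'; split; [apply: context_den|apply: mono].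
apply: (@for_reaches I J u) => //.
- by case: cs => ->.
- by move=> s' _ Is; apply: (@for_preserves I) => // s2 _; apply: Istep.
- by move=> s' _ _ Js; apply: (@for_preserves J) => // s2 _; apply: mono.
move=> s1 s1u I1.
apply: (@for_reaches (fun s => I s /\ var s 10 = u) J w) => //.
- by case: I1 => -[-> _].
- by move=> s2 _ [? ?]; split; [apply: Istep|rewrite den_var].
- by move=> s2 _ _; apply: mono.
move=> s2 s2w [I2 s2u].
rewrite den_when (eval_adj (proj1 I2) s2u s2w) uw.
apply: (@seqs_reaches (fun s => I s /\ var s 10 = u /\ var s 11 = w) J _ _ _ (map_In force ord)) => //.
- move=> q /In_map[[[a f] a'] _ ->] s3 [[cs3 bu3] [s3u s3w]]; split; last first.
    rewrite (den_force _ _ _ cs3 s3u s3w); by case: ifP.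
  split; last exact: mark_force_mono.
  rewrite (den_force _ _ _ cs3 s3u s3w); case: ifP => // _; by case: cs3.
- by move=> q /In_map[[[a f] a'] _ ->] s3; apply: mark_force_mono.
move=> s3 [[cs3 bu3] [s3u s3w]].
by rewrite (den_force _ _ _ cs3 s3u s3w) bu3 eqxx /= /J mark_put !eqxx.
Qed.

(** * Reaching the fixed point of propagation *)

(** There are only [3 * n] possible marks, so [3 * n] passes suffice; a loop has [n] iterations,
    hence three passes in each. *)
Definition rounds : prog := PFor 9 (PSeq propagate (PSeq propagate propagate)).

Lemma den_seq p q s : den (PSeq p q) s = den q (den p s).
Proof. by []. Qed.

Lemma den_unless a p s : den (unless a p) s = if eval s a == 0 then den p s else s.
Proof. by rewrite /=; case: eqP. Qed.

Definition marks (n : nat) (s : state) (b : nat) (v : 'I_n) : bool := mark s b v.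

Arguments marks n s b v : clear implicits.

Definition mark_set (n : nat) (s : state) : {set 'I_3 * 'I_n} := [set l : 'I_3 * 'I_n | mark s l.1 l.2].

(** A pass that adds no mark leaves a closed family by [propagate_step]. A family that is already
    closed gains nothing, by [propagate_below] applied to the family itself. *)
Lemma propagate_closed_or_grows n (e : rel 'I_n) (X : 'I_n -> nat) s m :
  (forall v, X v < 3) -> context e X s ->
  closed_under_forcing e X (marks n s) \/ m <= #|mark_set n s| ->
  closed_under_forcing e X (marks n (den propagate s)) \/ m < #|mark_set n (den propagate s)|.
Proof.
move=> X3 cs [cl|ms].
  left=> u w b b' uw b3 bu b'3 b'b b'X bX; apply: mark_propagate_mono.
  by apply: (cl u w b b') => //; apply: (propagate_below cl cs) bu.
have sub : mark_set n s \subset mark_set n (den propagate s).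
  by apply/subsetP => l; rewrite !inE; apply: mark_propagate_mono.
have [eq|neq] := eqVneq (mark_set n s) (mark_set n (den propagate s)); last first.
  by right; apply: leq_ltn_trans ms (proper_card _); rewrite properEneq neq.
left=> u w b b' uw b3 bu; apply: (propagate_step X3 cs uw b3).
by have := in_set (fun l : 'I_3 * 'I_n => mark s l.1 l.2) (Ordinal b3, u);
  rewrite -/(mark_set n s) eq inE => <-.
Qed.

Lemma context_propagate n (e : rel 'I_n) X s : context e X s -> context e X (den propagate s).
Proof. exact: context_den. Qed.

Lemma rounds_closed n (e : rel 'I_n) (X : 'I_n -> nat) s b (v : 'I_n) :
  (forall v, X v < 3) -> context e X s -> b < 3 -> mark s b v ->
  closed_under_forcing e X (marks n (den rounds s)).
Proof.
move=> X3 cs b3 bv.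
(* The initial mark accounts for the successor. After [n] iterations the second alternative would
   give more than [3 * n] marks. *)
pose I k s := context e X s /\
  (closed_under_forcing e X (marks n s) \/ (k * 3).+1 <= #|mark_set n s|).
suff [_ [//|]] : I n (den rounds s).
  have : #|mark_set n (den rounds s)| <= 3 * n.
    by apply: leq_trans (max_card _) _; rewrite card_prod !card_ord.
  by move=> le lt; have := leq_trans lt le; rewrite mulnC ltnn.
have s0 : var s 0 = n by case: cs.
rewrite -[X in I X]s0; apply: (@for_invariant I).
- by move=> k s' x [cs' ?]; split=> //; apply: context_assign.
- move=> k s1 _ [cs1 H1] _; rewrite !den_seq.
  have cs2 := context_propagate cs1; have cs3 := context_propagate cs2.
  have H2 := propagate_closed_or_grows X3 cs1 H1.
  have H3 := propagate_closed_or_grows X3 cs2 H2.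
  split; first exact: context_propagate.
  have [?|H4] := propagate_closed_or_grows X3 cs3 H3; first by left.
  by right; apply: leq_trans H4; lia.
split=> //; right; apply/card_gt0P; exists (Ordinal b3, v).
by rewrite inE.
Qed.

Lemma rounds_below n (e : rel 'I_n) X C s : closed_under_forcing e X C -> context e X s ->
  (forall b (v : 'I_n), b < 3 -> mark s b v -> C b v) ->
  forall b (v : 'I_n), b < 3 -> mark (den rounds s) b v -> C b v.
Proof.
move=> Ccl cs sC.
pose I s := context e X s /\ forall b (v : 'I_n), b < 3 -> mark s b v -> C b v.
suff [] : I (den rounds s) by [].
apply: (@for_preserves I) => [s' v [cs' H]|s1 _ [cs1 H1]|]; last by split.
  by split; [apply: context_assign|exact: H].
rewrite !den_seq; have cs2 := context_propagate cs1; have cs3 := context_propagate cs2.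
split; first exact: context_propagate.
exact: propagate_below Ccl cs3 (propagate_below Ccl cs2 (propagate_below Ccl cs1 H1)).
Qed.

Lemma rounds_mono s b v : mark s b v -> mark (den rounds s) b v.
Proof.
pose I s : Prop := mark s b v; rewrite -!/(I _).
by apply: (@for_preserves I) => // s1 _ I1; rewrite !den_seq; do 3!apply: mark_propagate_mono.
Qed.

Definition clear_marks : prog :=
  PFor 8 (seqs [seq PPut (3 + b) (Var 8) (Const 0) | b <- iota 0 3]).

Lemma mark_clear_step s b w : b < 3 ->
  mark (den (seqs [seq PPut (3 + b) (Var 8) (Const 0) | b <- iota 0 3]) s) b w =
  (w != var s 8) && mark s b w.
Proof.
by case: b => [|[|[|//]]] _; rewrite /mark /= /upd /=; case: (w == var s 8).
Qed.

Lemma clear_marksP s b v : b < 3 -> v < var s 0 -> mark (den clear_marks s) b v = false.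
Proof.
move=> b3; pose I k s := forall v, v < k -> mark s b v = false.
suff H : I (var s 0) (den clear_marks s) by apply: H.
apply: (@for_invariant I) => // k s1 _ I1 s1k w; rewrite mark_clear_step // s1k ltnS leq_eqVlt.
by case: eqP => //= _; apply: I1.
Qed.

Definition collide (t : nat * nat) : prog :=
  when (Get (3 + t.1) (Var 8)) (when (Get (3 + t.2) (Var 8)) (PAssign 5 (Const 1))).

Definition color_pairs : seq (nat * nat) := [:: (0, 1); (0, 2); (1, 0); (1, 2); (2, 0); (2, 1)].

Definition conflict : prog :=
  PSeq (PAssign 5 (Const 0)) (PFor 8 (seqs (map collide color_pairs))).

Definition functional_marks (n : nat) (s : state) : Prop :=
  forall b b' (w : 'I_n), b < 3 -> b' < 3 -> mark s b w -> mark s b' w -> b = b'.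

Lemma den_collide s t : den (collide t) s =
  if mark s t.1 (var s 8) && mark s t.2 (var s 8) then assign s 5 1 else s.
Proof. by rewrite /collide !den_when /mark /=; do 2!case: (_ != 0). Qed.

Lemma conflictP n s : var s 0 = n ->
  var (den conflict s) 5 = 0 <-> functional_marks n s.
Proof.
move=> s0; rewrite /conflict den_seq; set s1 := den (PAssign 5 _) s.
have s10 : var s1 0 = n by [].
split=> [nc b b' w b3 b'3 bw b'w|fm].
  apply/eqP/negPn/negP => bb'; suff : var (den (PFor 8 (seqs (map collide color_pairs))) s1) 5 != 0.
    by rewrite nc.
  pose I s := mark s b w /\ mark s b' w; pose J s : Prop := var s 5 != 0; rewrite -/(J _).
  have ord : (b, b') \in color_pairs.
    by case: b b' b3 b'3 bb' {bw b'w I} => [|[|[|//]]] [|[|[|//]]].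
  have Istep q : List.In q (map collide color_pairs) -> forall s, I s -> I (den q s).
    by move=> /In_map[t _ ->] s2 ?; rewrite den_collide; case: ifP.
  have Jstep q : List.In q (map collide color_pairs) -> forall s, J s -> J (den q s).
    by move=> /In_map[t _ ->] s2 ?; rewrite den_collide; case: ifP.
  apply: (@for_reaches I J w) => //; first by rewrite s10.
  - by move=> s2 _; apply: seqs_preserves.
  - by move=> s2 _ _; apply: seqs_preserves.
  move=> s2 s2w I2.
  apply: (@seqs_reaches (fun s => I s /\ var s 8 = w) J _ _ _ (map_In collide ord)) => //.
    by move=> q /In_map[t _ ->] s3 ?; rewrite den_collide; case: ifP.
  by move=> s3 [[bw3 b'w3] s3w]; rewrite den_collide s3w bw3 b'w3.
pose I s := var s 5 = 0 /\ functional_marks n s.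
suff [] : I (den (PFor 8 (seqs (map collide color_pairs))) s1) by [].
apply: (@for_preserves I) => // s2 w_lt I2; rewrite s10 in w_lt; pose w := Ordinal w_lt.
suff [] : I (den (seqs (map collide color_pairs)) s2) /\
  var (den (seqs (map collide color_pairs)) s2) 8 = w by [].
apply: (@seqs_preserves (fun s => I s /\ var s 8 = w)) => // q.
case/In_map=> -[b b'] ord -> s3 [I3 s3w]; rewrite den_collide s3w /=.
case: ifP => // /andP[bw b'w].
have [b3 b'3 bb'] : [/\ b < 3, b' < 3 & b != b'].
  by move: ord; rewrite !inE => /or4P[|||/or3P[]] /eqP[-> ->].
by rewrite (proj2 I3 b b' w b3 b'3 bw b'w) eqxx in bb'.
Qed.

(** Variable 7 holds the starting vertex; variable 5 ends nonzero exactly when some vertex has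
    received two colours. *)
Definition propagate_from (a : nat) : prog :=
  seqs [:: clear_marks; PPut (3 + a) (Var 7) (Const 1); rounds; conflict].

Lemma propagate_fromP n (e : rel 'I_n) (X : 'I_n -> nat) s (v : 'I_n) a :
  (forall v, X v < 3) -> context e X s -> var s 7 = v -> a < 3 ->
  let s' := den (propagate_from a) s in
  [/\ mark s' a v, closed_under_forcing e X (marks n s'),
      forall C, closed_under_forcing e X C -> C a v ->
        forall b (w : 'I_n), b < 3 -> mark s' b w -> C b w
    & var s' 5 = 0 <-> functional_marks n s'].
Proof.
move=> X3 cs sv a3 s'.
pose s1 := den clear_marks s; pose s2 := put s1 (3 + a) v 1; pose s3 := den rounds s2.
have cs1 : context e X s1 by apply: context_den.
have cs2 : context e X s2 by case: cs1.
have s'E : s' = den conflict s3.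
  by rewrite /s3 /s2 -sv -[var s 7](@den_var clear_marks s 7).
have s'm b w : b < 3 -> mark s' b w = mark s3 b w by move=> b3; rewrite s'E mark_den.
have av : mark s2 a v by rewrite mark_put !eqxx.
split.
- by rewrite s'm //; apply: rounds_mono.
- move=> u w b b' uw b3; rewrite /marks s'm // => bu b'3 b'b b'X bX; rewrite s'm //.
  exact: (rounds_closed X3 cs2 a3 av uw b3 bu).
- move=> C Ccl Cav b w b3; rewrite s'm //; apply: (rounds_below Ccl cs2) => // {}b {}w {}b3.
  rewrite mark_put clear_marksP ?orbF // => [/andP[/eqP-> /eqP/val_inj->] //|].
  by case: cs => ->.
have s30 : var s3 0 = n by rewrite den_var //; case: cs2.
rewrite s'E (conflictP s30) /functional_marks.
split=> H b b' w b3 b'3; first by rewrite !(@mark_den conflict) //; apply: H.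
by have := H b b' w b3 b'3; rewrite !(@mark_den conflict) //; apply.
Qed.

Definition try_color (a : nat) : prog :=
  unless (equals (Get 2 (Var 7)) a) (PSeq (propagate_from a) (unless (Var 5) (PAssign 3 (Const 1)))).

(** The hypothesis of [avoiding_coloring] at the vertex [v]. *)
Definition extendable (n : nat) (e : rel 'I_n) (X : 'I_n -> nat) (v : 'I_n) : Prop :=
  exists2 a, a < 3 & exists M : nat -> 'I_n -> bool,
    [/\ M a v, closed_under_forcing e X M, forall b w, M b w -> b < 3 /\ b != X w
      & forall b b' w, M b w -> M b' w -> b = b'].

Lemma den_try_color n (e : rel 'I_n) X s (v : 'I_n) a : context e X s -> var s 7 = v -> a < 3 ->
  var (den (try_color a) s) 3 =
  if (X v != a) && (var (den (propagate_from a) s) 5 == 0) then 1 else var s 3.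
Proof.
move=> [_ _ _ sX] sv a3; rewrite /try_color den_unless den_seq den_unless.
rewrite -[_ == 0]negbK eval_equals [eval s _]/= sv sX.
have : var (den (propagate_from a) s) 3 = var s 3 by rewrite den_var.
move: (den (propagate_from a) s) => s' s'3.
by case: (X v == a) => //=; case: eqP.
Qed.

Lemma try_color_mono s a : a < 3 -> var s 3 != 0 -> var (den (try_color a) s) 3 != 0.
Proof.
move=> a3 s3; rewrite /try_color den_unless den_seq den_unless.
have : var (den (propagate_from a) s) 3 = var s 3 by rewrite den_var.
move: (den (propagate_from a) s) => s' s'3.
by case: ifP => // _; case: ifP => // _; rewrite s'3.
Qed.

Lemma try_color_sound n (e : rel 'I_n) (X : 'I_n -> nat) s (v : 'I_n) a :
  (forall v, X v < 3) -> context e X s -> var s 7 = v -> a < 3 ->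
  var (den (try_color a) s) 3 != 0 -> var s 3 != 0 \/ extendable e X v.
Proof.
move=> X3 cs sv a3; rewrite (den_try_color cs sv a3); case: ifP; last by left.
case/andP=> Xa noconf _; right.
have [av cl least fm] := propagate_fromP X3 cs sv a3.
move/eqP: noconf => /(proj1 fm){}fm.
exists a => //; exists (fun b w => (b < 3) && mark (den (propagate_from a) s) b w); split.
- by rewrite a3.
- move=> u w b b' uw b3 /andP[_ bu] b'3 b'b b'X bX; rewrite b'3.
  exact: (cl u w b b').
- move=> b w /andP[b3 bw]; split=> //.
  (* A forced colour is never the forbidden one, so the non-forbidden colours are closed, and by
     leastness no mark is a forbidden colour. *)
  have cl' : closed_under_forcing e X (fun b w => b != X w) by move=> ? ? ? ? _ _ _ _ _ d'X _.
  have aX : a != X v by rewrite eq_sym.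
  exact: (least _ cl' aX b w b3 bw).
by move=> b b' w /andP[b3 bw] /andP[b'3 b'w]; apply: (fm b b' w).
Qed.

Definition avoiding (n : nat) (e : rel 'I_n) (X c : 'I_n -> nat) : Prop :=
  coloring e c /\ forall v, c v != X v.

(** The colouring [c], read as a family of marks, is closed under forcing. Propagation from its
    colour at [v] therefore stays inside it and meets no conflict. *)
Lemma try_color_complete n (e : rel 'I_n) (X c : 'I_n -> nat) s (v : 'I_n) :
  (forall v, X v < 3) -> context e X s -> var s 7 = v -> avoiding e X c ->
  var (den (try_color (c v)) s) 3 != 0.
Proof.
move=> X3 cs sv [[c3 pc] cX]; rewrite (den_try_color cs sv (c3 v)).
have [av cl least fm] := propagate_fromP X3 cs sv (c3 v).
have cl_c : closed_under_forcing e X (fun b w => c w == b).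
  move=> u w b b' uw b3 /eqP cu b'3 b'b b'X bX.
  by move: (c3 w) (cX w) (pc _ _ uw) (X3 w); rewrite cu; lia.
have below := least _ cl_c (eqxx _).
rewrite (eq_sym (X v)) cX (proj2 fm) // => b b' w b3 b'3 bw b'w.
by rewrite -(eqP (below _ _ b3 bw)); apply/eqP/below.
Qed.

(** Variable 3 records whether some colour works at the vertex in variable 7; variable 4 drops to 0
    once a vertex has no such colour. *)
Definition check_vertex : prog :=
  PSeq (PAssign 3 (Const 0))
    (PSeq (seqs (map try_color (iota 0 3))) (unless (Var 3) (PAssign 4 (Const 0)))).

(** Variable 1 holds the answer. It is set on success and never reset, so one successful guess
    decides. *)
Definition test : prog :=
  PSeq (PAssign 4 (Const 1)) (PSeq (PFor 7 check_vertex) (when (Var 4) (PAssign 1 (Const 1)))).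

Lemma test_mono s : var s 1 != 0 -> var (den test s) 1 != 0.
Proof.
move=> s1; rewrite !den_seq den_when; case: ifP => // _.
by rewrite den_var.
Qed.

Lemma context_try_color n (e : rel 'I_n) X s a : a < 3 -> context e X s ->
  context e X (den (try_color a) s).
Proof. by move=> a3; apply: context_den; case: a a3 => [|[|[|]]]. Qed.

Lemma var_try_color s a x : a < 3 -> x \notin assigned (try_color 0) ->
  var (den (try_color a) s) x = var s x.
Proof. by move=> a3 xt; rewrite den_var. Qed.

Lemma test_sound n (e : rel 'I_n) (X : 'I_n -> nat) s : simple_graph e ->
  (forall v, X v < 3) -> context e X s ->
  var (den test s) 1 != 0 -> var s 1 != 0 \/ exists c, coloring e c.
Proof.
move=> sg X3 cs; rewrite !den_seq den_when; set s1 := den (PAssign 4 _) s.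
case: ifP => [ok _|_]; last by rewrite den_var //; left.
right; apply: (@avoiding_coloring _ _ X) => //.
have cs1 : context e X s1 by apply: context_assign.
pose I k s := context e X s /\ (var s 4 != 0 -> forall v : 'I_n, v < k -> extendable e X v).
have s10 : var s1 0 = n by case: cs1.
suff [_ ext] : I n (den (PFor 7 check_vertex) s1).
  by move=> v; apply: ext.
rewrite -[X in I X]s10; apply: (@for_invariant I) => // k s2 k_lt [cs2 ext2] s2k.
rewrite s10 in k_lt; pose v := Ordinal k_lt.
split; first exact: context_den.
rewrite den_seq; set s3 := den (PAssign 3 _) s2; rewrite den_seq den_unless.
set s4 := den (seqs (map try_color (iota 0 3))) s3; rewrite [eval s4 _]/=.
case: ifPn => // good; rewrite [var s4 4]den_var // => ok2 w.
rewrite ltnS leq_eqVlt => /orP[/eqP wk|]; last exact: ext2.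
have -> : w = v by apply: val_inj.
have : context e X s4 /\ var s4 7 = v /\ (var s4 3 != 0 -> extendable e X v).
  apply: (@seqs_preserves (fun s => context e X s /\ var s 7 = v /\ (var s 3 != 0 -> extendable e X v))).
    move=> q /In_map[a]; rewrite mem_iota add0n => a3 -> s5 [cs5 [s5v ext5]].
    split; first exact: context_try_color.
    split; first by rewrite var_try_color.
    by case/(try_color_sound X3 cs5 s5v a3).
  by split; first exact: context_assign.
by case=> _ [_]; apply.
Qed.

Lemma test_complete n (e : rel 'I_n) (X c : 'I_n -> nat) s :
  (forall v, X v < 3) -> context e X s -> avoiding e X c ->
  var (den test s) 1 != 0.
Proof.
move=> X3 cs av; have [[c3 pc] cX] := av.
rewrite !den_seq den_when; set s1 := den (PAssign 4 _) s.
have cs1 : context e X s1 by apply: context_assign.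
pose I s := context e X s /\ var s 4 != 0.
have s10 : var s1 0 = n by case: cs1.
suff [_] : I (den (PFor 7 check_vertex) s1).
  by move: (den (PFor 7 check_vertex) s1) => s2 ok; rewrite /= ok.
apply: (@for_preserves I) => // s2 v_lt [cs2 ok2].
rewrite s10 in v_lt; pose v := Ordinal v_lt.
split; first exact: context_den.
rewrite den_seq; set s3 := den (PAssign 3 _) s2; rewrite den_seq den_unless.
set s4 := den (seqs (map try_color (iota 0 3))) s3; rewrite [eval s4 _]/=.
suff /negbTE-> : var s4 3 != 0 by rewrite [var s4 4]den_var.
have cvI : c v \in iota 0 3 by rewrite mem_iota add0n c3.
pose K s := context e X s /\ var s 7 = v; pose J s : Prop := var s 3 != 0; rewrite -/(J _).
apply: (@seqs_reaches K J _ _ _ (map_In try_color cvI)) => //.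
- move=> q /In_map[a]; rewrite mem_iota add0n => a3 -> s5 [cs5 s5v].
  by split; [apply: context_try_color|rewrite var_try_color].
- move=> q /In_map[a]; rewrite mem_iota add0n => a3 -> s5.
  exact: try_color_mono.
- by move=> s5 [cs5 s5v]; apply: (try_color_complete X3 cs5 s5v av).
Qed.

(** * Forbidden colours from a guess *)

(** The forbidden colours are read off array 2 itself, so the condition leaves them free while the
    array is being filled. *)
Definition base (n : nat) (e : rel 'I_n) (s : state) : Prop :=
  context e (fun i => arr s 2 i) s.

Lemma base_den n (e : rel 'I_n) p s :
  0 \notin assigned p -> (0 \notin written p) && (1 \notin written p) ->
  base e s -> base e (den p s).
Proof. by move=> p0 /andP[w0 w1] [? ? ? _]; split=> // *; rewrite ?den_var ?den_arr. Qed.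

Lemma base_assign n (e : rel 'I_n) s x v : x != 0 -> base e s -> base e (assign s x v).
Proof. exact: context_assign. Qed.

Lemma base_put n (e : rel 'I_n) s i v : base e s -> base e (put s 2 i v).
Proof. by case. Qed.

(* Variables 14 + 2 a and 15 + 2 a hold the two vertices guessed to have
   colour a. *)

Definition sees (a x : nat) : expr := Add (adj x (14 + 2 * a)) (adj x (15 + 2 * a)).

(** A vertex, in variable 13, that sees guessed colours [a] and [b] must have colour [d], which is
    therefore excluded at its neighbour in variable 12. *)
Definition exclude_third (t : nat * nat * nat) : prog :=
  let: (a, b, d) := t in when (sees a 13) (when (sees b 13) (PPut 2 (Var 12) (Const d))).

Definition exclude_seen (a : nat) : prog := when (sees a 12) (PPut 2 (Var 12) (Const a)).

Definition forbid_from_neighbor : prog :=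
  when (adj 12 13) (seqs (map exclude_third [:: (0, 1, 2); (0, 2, 1); (1, 2, 0)])).

(** The default 0 is overwritten only by colours that the guess excludes. It survives only at
    unreduced vertices, where a good guess excludes 0. *)
Definition forbid : prog :=
  PFor 12 (PSeq (PPut 2 (Var 12) (Const 0))
    (PSeq (PFor 13 forbid_from_neighbor) (seqs (map exclude_seen (iota 0 3))))).

Definition guessed (n : nat) (g : nat -> 'I_n) (s : state) : Prop :=
  forall k, k < 6 -> var s (14 + k) = g k.

Definition seen (n : nat) (e : rel 'I_n) (g : nat -> 'I_n) (a : nat) : pred 'I_n :=
  near e (g (2 * a)) (g (2 * a).+1).

Lemma eval_sees n (e : rel 'I_n) g s a x (v : 'I_n) : base e s -> guessed g s -> a < 3 ->
  var s x = v -> (eval s (sees a x) != 0) = seen e g a v.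
Proof.
move=> bs gs a3 sv.
have -> : eval s (sees a x) = eval s (adj x (14 + 2 * a)) + eval s (adj x (15 + 2 * a)) by [].
rewrite addn_eq0 negb_and (eval_adj (i := v) (j := g (2 * a)) bs) //; last by rewrite gs //; lia.
rewrite (eval_adj (i := v) (j := g (2 * a).+1) bs) //.
by rewrite -(gs (2 * a).+1); [congr (var s _)|]; lia.
Qed.

Lemma arr_put2 s i v j : arr (put s 2 i v) 2 j = if j == i then v else arr s 2 j.
Proof. by []. Qed.

(** This covers wrong guesses too: soundness of [test] relies on it after each of them. *)
Lemma forbid_lt3 s : (forall v, arr s 2 v < 3) -> forall v, arr (den forbid s) 2 v < 3.
Proof.
pose I s := forall v, arr s 2 v < 3; rewrite -!/(I _).
have Iput s' i v : v < 3 -> I s' -> I (put s' 2 i v).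
  by move=> v3 Is w; rewrite arr_put2; case: ifP.
apply: (@for_preserves I) => // s1 _ I1; rewrite 2!den_seq.
apply: (@seqs_preserves I) => [q /In_map[a]|].
  rewrite mem_iota add0n => a3 -> s2 I2; rewrite den_when.
  by case: ifP => // _; apply: Iput.
apply: (@for_preserves I) => // [s2 _ I2|]; last exact: Iput.
rewrite den_when; case: ifP => // _.
apply: (@seqs_preserves I) => // q /In_map[[[a b] d] abd -> s3 I3].
rewrite /exclude_third !den_when; do 2!case: ifP => // _; apply: Iput => //.
by move: abd; rewrite !inE => /or3P[] /eqP[_ _ ->].
Qed.

(** The second alternative of [normalized_guess], with [g] listing [p], [s], [q], [w], [r], [x]. *)
Definition good_guess (n : nat) (e : rel 'I_n) (g : nat -> 'I_n) (c : 'I_n -> nat) : Prop :=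
  [/\ coloring e c, forall a, a < 3 -> c (g (2 * a)) = a /\ c (g (2 * a).+1) = a
    & forall y, unreduced e (seen e g 0) (seen e g 1) (seen e g 2) y -> c y != 0].

Lemma seen_neq n (e : rel 'I_n) g c a v : good_guess e g c -> a < 3 -> seen e g a v -> c v != a.
Proof.
move=> [[_ pc] cg _] a3; have [E1 E2] := cg _ a3.
by case/orP=> /pc; rewrite ?E1 ?E2.
Qed.

Lemma third_neq n (e : rel 'I_n) g c v z a b d : good_guess e g c -> e v z ->
  (a, b, d) \in color_orders -> seen e g a z -> seen e g b z -> c v != d.
Proof.
rewrite color_ordersP => gg vz /and5P[a3 b3 d3 ab /andP[ad bd]] az bz.
have [[c3 pc] _ _] := gg.
by move: (seen_neq gg a3 az) (seen_neq gg b3 bz) (c3 z) (pc _ _ vz); lia.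
Qed.

Definition forbidding (n : nat) (e : rel 'I_n) (g : nat -> 'I_n) (c : 'I_n -> nat) (v : 'I_n) s : Prop :=
  [/\ base e s, guessed g s, var s 12 = v & forall w : 'I_n, w < v -> c w != arr s 2 w].

Lemma forbidding_put n (e : rel 'I_n) g c v s d :
  forbidding e g c v s -> forbidding e g c v (put s 2 v d).
Proof.
case=> bs gs sv below; split=> //; first exact: base_put.
move=> w wv; rewrite arr_put2; case: (nat_of_ord w =P v) => [wE|_]; last exact: below.
by rewrite wE ltnn in wv.
Qed.

Lemma den_exclude_third n (e : rel 'I_n) g c v (z : 'I_n) s a b d :
  forbidding e g c v s -> var s 13 = z -> a < 3 -> b < 3 ->
  den (exclude_third (a, b, d)) s = if seen e g a z && seen e g b z then put s 2 v d else s.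
Proof.
case=> bs gs sv below sz a3 b3; rewrite /exclude_third !den_when !(eval_sees bs gs _ sz) //.
by case: (seen e g a z) => //=; rewrite sv.
Qed.

Lemma den_exclude_seen n (e : rel 'I_n) g c v s a : forbidding e g c v s -> a < 3 ->
  den (exclude_seen a) s = if seen e g a v then put s 2 v a else s.
Proof.
case=> bs gs sv below a3; rewrite /exclude_seen !den_when !(eval_sees bs gs _ sv) //.
by case: (seen e g a v) => //=; rewrite sv.
Qed.

Definition sees_two (n : nat) (e : rel 'I_n) (g : nat -> 'I_n) (z : 'I_n) : bool :=
  [|| seen e g 0 z && seen e g 1 z, seen e g 0 z && seen e g 2 z | seen e g 1 z && seen e g 2 z].

(** [P m] is the loop invariant after [m] candidate neighbours. Every write is justified by
    [third_neq], so a justified entry stays justified; the default remains only while no neighbour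
    has seen two colours. *)
Lemma forbid_from_neighborP n (e : rel 'I_n) g c v m s : good_guess e g c -> m < n -> var s 13 = m ->
  let P m s := forbidding e g c v s /\ (c v != arr s 2 v \/
    arr s 2 v = 0 /\ forall z : 'I_n, z < m -> e v z -> ~~ sees_two e g z) in
  P m s -> P m.+1 (den forbid_from_neighbor s).
Proof.
move=> gg mn sm P [Fs H]; pose z := Ordinal mn; have [bs gs sv _] := Fs.
rewrite /forbid_from_neighbor den_when (eval_adj (j := z) bs sv sm).
have next : ~~ e v z || ~~ sees_two e g z -> P m.+1 s.
  move=> nz; split=> //; case: H => [|[X0 H]]; [by left|right; split=> // w].
  rewrite ltnS leq_eqVlt => /orP[/eqP wm vw|]; last exact: H.
  by have wz : w = z by [apply: val_inj]; rewrite -wz vw in nz.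
case: (boolP (e v z)) => [vz|nvz]; last by apply: next; rewrite nvz.
set l := [:: _; _; _].
pose I s := forbidding e g c v s /\ var s 13 = z; pose J s := I s /\ c v != arr s 2 v.
have l_third t : t \in l -> [/\ t \in color_orders, t.1.1 < 3 & t.1.2 < 3].
  by rewrite !inE => /or3P[] /eqP->.
have Istep q : List.In q (map exclude_third l) -> forall s, I s -> I (den q s).
  case/In_map=> -[[a b] d] /l_third[_ a3 b3] -> s' [F' sz].
  rewrite (den_exclude_third _ F' sz) //; case: ifP => // _.
  by split; first exact: forbidding_put.
have [two|ntwo] := boolP (sees_two e g z); last first.
  suff -> : den (seqs (map exclude_third l)) s = s by apply: next; rewrite ntwo orbT.
  apply: (@seqs_preserves (fun s' => s' = s)) => // q /In_map[t tl ->] _ ->.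
  have [_] := l_third _ tl; case: t tl => [[a b] d] tl a3 b3.
  rewrite (den_exclude_third (z := z) _ Fs sm) //; case: ifP => // /andP[az bz].
  by move: ntwo tl; rewrite /sees_two !inE => + /or3P[] /eqP[aE bE _];
    move: az bz; rewrite aE bE => -> ->; rewrite ?orbT.
have [[[a b] d] tl /andP[az bz]] : exists2 t, t \in l & seen e g t.1.1 z && seen e g t.1.2 z.
  by case/or3P: two => ?; [exists (0, 1, 2)|exists (0, 2, 1)|exists (1, 2, 0)].
suff [[Fs' _] cX] : J (den (seqs (map exclude_third l)) s) by split; [|left].
have [ord a3 b3] := l_third _ tl.
apply: (@seqs_reaches I J _ _ _ (map_In exclude_third tl)) => //.
  move=> q ql s' [Is' cX']; split; first exact: Istep.
  move: ql => /In_map[[[a' b'] d'] tl' ->]; have [ord' a'3 b'3] := l_third _ tl'.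
  rewrite (den_exclude_third _ (proj1 Is') (proj2 Is')) //; case: ifP => // /andP[a'z b'z].
  by rewrite arr_put2 eqxx (third_neq gg vz ord').
move=> s' [F' sz]; rewrite (den_exclude_third _ F' sz) // az bz; split.
  by split; first exact: forbidding_put.
by rewrite arr_put2 eqxx (third_neq gg vz ord).
Qed.

Lemma forbid_avoids n (e : rel 'I_n) g c s : good_guess e g c -> base e s -> guessed g s ->
  forall v : 'I_n, c v != arr (den forbid s) 2 v.
Proof.
move=> gg bs gs; have s0 : var s 0 = n by case: bs.
pose I k s := [/\ base e s, guessed g s & forall w : 'I_n, w < k -> c w != arr s 2 w].
suff [_ _ H] : I n (den forbid s) by move=> v; apply: H.
have guessed_assign x s' v : x < 14 -> guessed g s' -> guessed g (assign s' x v).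
  by move=> x14 gs' k k6; rewrite /= /upd; case: eqP => [|_]; [lia|apply: gs'].
rewrite -[X in I X]s0; apply: (@for_invariant I) => [k s' v [b' g' H]|k s1 k_lt [b1 g1 H1] s1k|].
- by split; [apply: base_assign|apply: guessed_assign|exact: H].
- rewrite s0 in k_lt; pose v := Ordinal k_lt; rewrite 2!den_seq.
  set s2 := den (PPut _ _ _) s1; set s3 := den (PFor _ _) s2.
  have s2E : s2 = put s1 2 v 0 by rewrite /s2 [nat_of_ord v]/= -s1k.
  have F2 : forbidding e g c v s2 by rewrite s2E; apply: forbidding_put.
  pose P m s := forbidding e g c v s /\ (c v != arr s 2 v \/
    arr s 2 v = 0 /\ forall z : 'I_n, z < m -> e v z -> ~~ sees_two e g z).
  have [F3 H3] : P n s3.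
    have s20 : var s2 0 = n by case: F2 => -[].
    rewrite -[X in P X]s20; apply: (@for_invariant P) => [m s' x [[b' g' v' H'] D]|m s' m_lt P' s'm|].
    - by split; [split; [apply: base_assign|apply: guessed_assign| |]|].
    - by rewrite s20 in m_lt; apply: (forbid_from_neighborP gg m_lt s'm P').
    by split=> //; right; split=> //; rewrite s2E arr_put2 eqxx.
  suff [F cX] : forbidding e g c v (den (seqs (map exclude_seen (iota 0 3))) s3) /\
      c v != arr (den (seqs (map exclude_seen (iota 0 3))) s3) 2 v.
    case: F => b' g' _ H'; split=> // w; rewrite ltnS leq_eqVlt => /orP[/eqP wk|]; last exact: H'.
    by have -> : w = v by apply: val_inj.
  pose J s := forbidding e g c v s /\ c v != arr s 2 v.
  have Istep q : List.In q (map exclude_seen (iota 0 3)) ->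
      forall s, forbidding e g c v s -> forbidding e g c v (den q s).
    move=> /In_map[a]; rewrite mem_iota add0n => a3 -> s' F'.
    by rewrite (den_exclude_seen F') //; case: ifP => // _; apply: forbidding_put.
  have Jstep q : List.In q (map exclude_seen (iota 0 3)) -> forall s, J s -> J (den q s).
    move=> /In_map[a]; rewrite mem_iota add0n => a3 -> s' [F' cX].
    rewrite (den_exclude_seen F') //; case: ifP => // av; split; first exact: forbidding_put.
    by rewrite arr_put2 eqxx (seen_neq gg a3 av).
  case: (boolP [|| seen e g 0 v, seen e g 1 v | seen e g 2 v]) => [some|none].
    have [a aI av] : exists2 a, a \in iota 0 3 & seen e g a v.
      by case/or3P: some => ?; [exists 0|exists 1|exists 2].
    apply: (@seqs_reaches (forbidding e g c v) J _ _ _ (map_In exclude_seen aI)) => // s' F'.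
    move: aI; rewrite mem_iota add0n => a3; rewrite (den_exclude_seen F') // av.
    by split; [apply: forbidding_put|rewrite arr_put2 eqxx (seen_neq gg a3 av)].
  (* Here [v] has no guessed neighbour. If its entry is still the default, no neighbour sees two
     colours, so [v] is unreduced and does not have colour 0. *)
  apply: (@seqs_preserves J) => //; split=> //.
  case: H3 => [//|[-> nt]]; have [_ _ unred] := gg; apply: unred; split=> // z vz.
  exact: nt.
by [].
Qed.

(** * Enumerating all guesses *)

Fixpoint nest (xs : seq nat) (p : prog) : prog :=
  if xs is x :: xs' then PFor x (nest xs' p) else p.

Lemma nest_preserves (I : state -> Prop) xs p s :
  (forall x s v, x \in xs -> I s -> I (assign s x v)) -> (forall s, I s -> I (den p s)) ->
  I s -> I (den (nest xs p) s).
Proof.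
elim: xs s => [|x xs IHxs] s Ix Ip Is; first exact: Ip.
apply: (@for_preserves I) => // [s' v|s' _ Is']; first by apply: Ix; rewrite mem_head.
by apply: IHxs => // y s1 v yxs; apply: Ix; rewrite in_cons yxs orbT.
Qed.

Lemma nest_reaches (g : nat -> nat) n (I J : state -> Prop) xs p s : uniq xs ->
  (forall x, x \in xs -> g x < n) -> (forall x, x \in xs -> x \notin assigned p) ->
  (forall s, I s -> var s 0 = n) ->
  (forall x s v, x \in xs -> I s -> I (assign s x v)) ->
  (forall x s v, x \in xs -> J s -> J (assign s x v)) ->
  (forall s, I s -> I (den p s)) -> (forall s, J s -> J (den p s)) ->
  (forall s, I s -> (forall x, x \in xs -> var s x = g x) -> J (den p s)) ->
  I s -> J (den (nest xs p) s).
Proof.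
elim: xs s I => [|x xs IHxs] s I /=; first by move=> _ _ _ _ _ _ _ _ hit Is; apply: hit.
move=> /andP[xxs uxs] gn xp I0 Ix Jx Ip Jp hit Is.
have tl y : y \in xs -> y \in x :: xs by move=> yxs; rewrite in_cons yxs orbT.
apply: (@for_reaches I J (g x)) => //.
- by rewrite I0 // gn ?mem_head.
- by move=> s' v; apply: Ix; rewrite mem_head.
- by move=> s' v; apply: Jx; rewrite mem_head.
- by move=> s' _; apply: nest_preserves => // y s1 v /tl; apply: Ix.
- by move=> s' _ _; apply: nest_preserves => // y s1 v /tl; apply: Jx.
move=> s' s'x Is'.
(* The invariant now also records that the outer counter has its intended value. *)
apply: (IHxs _ (fun s => I s /\ var s x = g x)) => //.
- by move=> y /tl; apply: gn.
- by move=> y /tl; apply: xp.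
- by move=> s1 [/I0].
- move=> y s1 v yxs [I1 s1x]; split; first by apply: Ix; first exact: tl.
  by rewrite /= /upd; case: eqP => // xy; rewrite xy yxs in xxs.
- by move=> y s1 v /tl; apply: Jx.
- by move=> s1 [I1 s1x]; split; [apply: Ip|rewrite den_var ?xp ?mem_head].
move=> s1 [I1 s1x] s1xs; apply: hit => // y; rewrite in_cons => /orP[/eqP->|] //; exact: s1xs.
Qed.

(** * The complete algorithm and its correctness *)

Definition row_offsets : prog :=
  PFor 6 (PSeq (PPut 1 (Var 6) (Var 2)) (PAssign 2 (Add (Var 2) (Var 0)))).

Definition guess_and_test : prog := nest (iota 14 6) (PSeq forbid test).

(** The first [test] runs while array 2 is still zero: it handles colourings that avoid colour 0.
    The nested loops then try all [n ^ 6] guesses. *)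
Definition decide : prog := PSeq row_offsets (PSeq test guess_and_test).

(** By Euclidean division the cell number determines [i] and [j], so the existential in [input] has
    only the intended witness. *)
Lemma input_edge n (e : rel 'I_n) (i j : 'I_n) : arr (input e) 0 (i * n + j) = e i j.
Proof.
rewrite /=; congr nat_of_bool; apply/existsP/idP => [[i' /existsP[j' /andP[/eqP E ij]]]|ij]; last first.
  by exists i; apply/existsP; exists j; rewrite eqxx.
have n0 : 0 < n by apply: leq_ltn_trans (ltn_ord i).
have := congr1 (divn^~ n) E; rewrite !divnMDl // !divn_small // !addn0 => /val_inj->.
by have := congr1 (modn^~ n) E; rewrite !modnMDl !modn_small // => /val_inj->.
Qed.

Lemma base_row_offsets n (e : rel 'I_n) : base e (den row_offsets (input e)).
Proof.
pose I k s := [/\ var s 0 = n, arr s 0 = arr (input e) 0, var s 2 = k * n &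
  forall i, i < k -> arr s 1 i = i * n].
have [s0 sa _ so] : I n (den row_offsets (input e)).
  apply: (@for_invariant I _ _ (input e)) => [k s v [? ? ? ?]|k s _ [s0 sa s2 so] sk|] //.
  split=> //; first by rewrite /= /upd /= s2 s0; lia.
  move=> i; rewrite ltnS leq_eqVlt /= /upd /= sk s2.
  by case: eqP => [->|_] //= ik; apply: so.
by split=> // [i j|i]; [rewrite sa input_edge|rewrite so].
Qed.

Lemma three_colorableP n (e : rel 'I_n) : three_colorable e <-> exists c, coloring e c.
Proof.
split=> [[c pc]|[c [c3 pc]]].
  by exists (fun v => c v); split=> [v|u v /pc]; first exact: ltn_ord.
exists (fun v => Ordinal (c3 v)) => u v /pc; by apply: contraNneq => /(congr1 val) /= ->.
Qed.

Definition sound_state (n : nat) (e : rel 'I_n) (s : state) : Prop :=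
  [/\ base e s, forall v, arr s 2 v < 3 & var s 1 != 0 -> exists c, coloring e c].

Lemma sound_test n (e : rel 'I_n) s : simple_graph e -> sound_state e s -> sound_state e (den test s).
Proof.
move=> sg [bs lt3 snd]; split; first exact: base_den.
  by move=> v; rewrite den_arr.
have X3 (v : 'I_n) : arr s 2 v < 3 by [].
by case/(test_sound sg X3 bs).
Qed.

Lemma sound_forbid n (e : rel 'I_n) s : sound_state e s -> sound_state e (den forbid s).
Proof.
move=> [bs lt3 snd]; split; first exact: base_den.
  exact: forbid_lt3.
by rewrite den_var.
Qed.

Lemma sound_assign n (e : rel 'I_n) s x v : 1 < x -> sound_state e s -> sound_state e (assign s x v).
Proof.
move=> x1 [bs lt3 snd]; split=> //; first by apply: base_assign => //; lia.
by rewrite /= /upd; case: (1 =P x) x1 => // <-.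
Qed.

Lemma sound_row_offsets n (e : rel 'I_n) : sound_state e (den row_offsets (input e)).
Proof.
split; first exact: base_row_offsets.
  by move=> v; rewrite den_arr.
by rewrite den_var.
Qed.

Lemma decide_sound n (e : rel 'I_n) : simple_graph e ->
  var (den decide (input e)) 1 != 0 -> three_colorable e.
Proof.
move=> sg; rewrite /decide 2!den_seq => /[dup] acc; rewrite three_colorableP.
suff [_ _ H _] : sound_state e (den guess_and_test (den test (den row_offsets (input e)))) by exact: H.
apply: (@nest_preserves (sound_state e)) => [x s v|s ss|].
- by rewrite mem_iota => /andP[x14 _]; apply: sound_assign; lia.
- by rewrite den_seq; apply: sound_test => //; apply: sound_forbid.
by apply: sound_test => //; apply: sound_row_offsets.
Qed.

Lemma decide_complete n (e : rel 'I_n) : simple_graph e -> diameter_two e ->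
  ~ induced_subgraph (cycle_graph 3) e -> ~ induced_subgraph (cycle_graph 7) e ->
  three_colorable e -> var (den decide (input e)) 1 != 0.
Proof.
move=> sg dia nC3 nC7 /three_colorableP/(normalized_guess sg dia nC3 nC7)[c cc].
rewrite /decide 2!den_seq; set s0 := den row_offsets (input e).
have ss0 : sound_state e s0 by exact: sound_row_offsets.
pose J s : Prop := var s 1 != 0; rewrite -/(J _).
have Jassign x0 s v : x0 \in iota 14 6 -> J s -> J (assign s x0 v).
  by rewrite mem_iota /J /= /upd; case: (1 =P x0) => // <-.
have Jstep s : J s -> J (den (PSeq forbid test) s).
  by rewrite /J den_seq => Js; apply: test_mono; rewrite den_var.
case=> [c0|[p [s [q [w [r [x [cp cs cq cw [cr cx free]]]]]]]]].
  apply: (@nest_preserves J) => //.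
  have [b0 lt3 _] := ss0.
  apply: (test_complete (e := e) (X := fun v : 'I_n => arr s0 2 v) (c := c)) => //; split=> // v.
  by rewrite [arr s0 2]den_arr //; apply: c0.
pose g k := nth p [:: p; s; q; w; r; x] k.
have gg : good_guess e g c by split=> // -[|[|[|//]]].
apply: (@nest_reaches (fun k => g (k - 14)) n (sound_state e)) => //.
- have small : all (fun y => y < 14) (assigned (PSeq forbid test)) by [].
  by move=> k; rewrite mem_iota => /andP[k14 _]; apply/negP => /(allP small); rewrite ltnNge k14.
- by move=> s1 [[]].
- by move=> k s1 v; rewrite mem_iota => /andP[k14 _]; apply: sound_assign; lia.
- by move=> s1 ss1; rewrite den_seq; apply: sound_test => //; apply: sound_forbid.
- move=> s1 ss1 s1g; have [b1 _ _] := ss1.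
  have g1 : guessed g s1.
    by move=> k k6; rewrite s1g ?addKn // mem_iota; lia.
  have [b2 lt3 _] := sound_forbid ss1.
  rewrite /J den_seq; apply: (test_complete (e := e) (X := fun v : 'I_n => arr (den forbid s1) 2 v) (c := c)) => //.
  by split=> //; apply: forbid_avoids gg b1 g1.
exact: sound_test.
Qed.

Theorem theorem2 :
  polytime_decidable
    (fun (n : nat) (e : rel 'I_n) =>
       [/\ diameter_two e,
           ~ induced_subgraph (cycle_graph 3) e
         & ~ induced_subgraph (cycle_graph 7) e])
    (fun (n : nat) (e : rel 'I_n) => three_colorable e).
Proof.
have [a [d time_decide]] := time_poly decide.
(* Variable 0 bounds the loops and must keep the value [n], so the answer is copied into it only at
   the end, at cost 2. *)
exists (Seq (compile decide) (Assign 0 (Var 1))), (a + 2), d => n e sg [dia nC3 nC7].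
have [//|t ex_decide t_le] := @exec_compile decide (input e) _.
exists (t + 2), (assign (den decide (input e)) 0 (var (den decide (input e)) 1)); split.
- exact: ExecSeq ex_decide (ExecAssign _ _ (Var 1)).
- have := leq_trans t_le (time_decide n); rewrite mulnDl; lia.
split; first exact: decide_sound.
exact: decide_complete.
Qed.
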